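(* Let $W(x)=\sum_{k=1}^\infty\sqrt{\lambda_k}\,\phi_k(x)Z_k$ be the Karhunen–Loève representation of a mean-zero Gaussian process on $[0,1]$ with continuous covariance kernel, where $Z_1,Z_2,\dots$ are i.i.d. standard normal, and fix a location $x$. Suppose there are $p>1$ and $q>0$ such that: (i) there are constants $0<\underline B\le\overline B<\infty$ with $\underline B\,k^{-p}\le\lambda_k\le\overline B\,k^{-p}$ for all $k$; (ii) there is $\overline C_x>0$ with $|\phi_k(x+h)-\phi_k(x)|\le\overline C_x\min\{1,hk^q\}$ for all $k$ and all sufficiently small $h>0$; (iii) there are $0<a<b<\infty$ and $c_x>0$ such that, for all sufficiently small $h>0$, $\displaystyle\sum_{ah^{-1/q}\le k\le bh^{-1/q}}(\phi_k(x+h)-\phi_k(x))^2\ge c_x\,h^{-1/q}$; (iv) $\phi_k'(x)\ne0$ for some $k$. Then $$\alpha^*(x)=\min\Big\{2,\frac{p-1}{q}\Big\},$$ where $\alpha^*(x):=\sup\{\alpha:\limsup_{h\to0}\mathbb E[(W(x+h)-W(x))^2]/h^\alpha<\infty\}$. In particular, for a fixed eigenbasis (hence fixed $q$), $\alpha^*(x)$ is weakly increasing in the eigenvalue decay rate $p$, strictly so for $1<p<1+2q$.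
   Context: In the Karhunen–Loève representation, $(\lambda_k,\phi_k)$ are the (strictly positive) eigenvalue–eigenfunction pairs of the covariance operator on $L^2[0,1]$, with $(\phi_k)$ orthonormal. Limits $h\to0$ are taken through $h>0$. A smaller $\alpha^*(x)$ is interpreted as more ''jagged'' sample paths at $x$. *)

(* Defs.v *)
(* MathComp + MathComp-Analysis *)
From HB Require Import structures.
From mathcomp Require Import all_boot all_order all_algebra.
From mathcomp Require Import all_classical all_reals all_analysis.

Set Implicit Arguments.
Unset Strict Implicit.
Unset Printing Implicit Defensive.

Import Order.TTheory GRing.Theory Num.Theory.
Import numFieldNormedType.Exports.
Local Open Scope classical_set_scope.
Local Open Scope ring_scope.

(* Processes, kernels and eigenfunctions are total functions on R; only their
   values on [0,1] are constrained or used.  Sequences are indexed from 0, so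
   that [lam k], [phi k], [Z k] stand for lambda_{k+1}, phi_{k+1}, Z_{k+1}; the
   rank appearing in growth conditions is therefore k.+1. *)

Section probability.
Context d (T : measurableType d) (R : realType) (P : probability T R).

(* Laws are compared on measurable sets only: outside the sigma-algebra the
   values of the set functions involved are meaningless. *)
Definition has_law (X : T -> R) (mu : set R -> \bar R) : Prop :=
  forall A : set R, measurable A -> P (X @^-1` A) = mu A.

(* Point masses count as (degenerate) Gaussian laws; [normal_prob m s] has the
   Gaussian density only for s != 0. *)
Definition gaussian (X : T -> R) : Prop :=
  exists m : R, has_law X \d_m \/
    exists2 s : R, 0 < s & has_law X (normal_prob m s).

Definition gaussian_process (W : R -> {RV P >-> R}) : Prop :=
  forall (n : nat) (t a : 'I_n -> R), (forall i, t i \in `[0, 1]) ->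
    gaussian (fun w => \sum_(i < n) a i * W (t i) w).

Definition mean_zero (W : R -> {RV P >-> R}) : Prop :=
  forall t : R, t \in `[0, 1] -> ('E_P[W t] = 0)%E.

Definition cov_kernel (W : R -> {RV P >-> R}) (s t : R) : R :=
  fine (covariance P (W s) (W t)).

Definition mutually_independent (Z : nat -> {RV P >-> R}) : Prop :=
  forall (J : seq nat) (A : nat -> set R),
    uniq J -> (forall k, measurable (A k)) ->
    P (\bigcap_(k in [set` J]) (Z k @^-1` A k)) =
    (\prod_(k <- J) P (Z k @^-1` A k))%E.

Definition iid_standard_normal (Z : nat -> {RV P >-> R}) : Prop :=
  mutually_independent Z /\ forall k, has_law (Z k) (normal_prob 0 1).

End probability.

Section L2.
Context (R : realType).
Local Notation mu := (@lebesgue_measure R).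

Definition in_L2 (f : R -> R) : Prop :=
  measurable_fun (`[0, 1] : set R) f /\
  mu.-integrable `[0, 1] (fun t => (f t ^+ 2)%:E).

Definition orthonormal_L2 (phi : nat -> R -> R) : Prop :=
  forall j k, Rintegral mu `[0, 1] (fun t => phi j t * phi k t) = (j == k)%:R.

Definition integral_operator (K : R -> R -> R) (f : R -> R) (s : R) : R :=
  Rintegral mu `[0, 1] (fun t => K s t * f t).

(* Equality in L^2[0,1], hence almost everywhere. *)
Definition eigenpair (K : R -> R -> R) (l : R) (f : R -> R) : Prop :=
  in_L2 f /\
  {ae mu, forall s, s \in `[0, 1] -> integral_operator K f s = l * f s}.

(* One-sided at the endpoints of [0,1], two-sided inside. *)
Definition has_derivative (f : R -> R) (x l : R) : Prop :=
  (f y - f x) / (y - x) @[y --> within `[0, 1] x^'] --> l.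

Definition power_decay (lam : nat -> R) (p : R) : Prop :=
  exists Bl Bu : R, [/\ 0 < Bl, Bl <= Bu &
    forall k, Bl * k.+1%:R `^ (- p) <= lam k <= Bu * k.+1%:R `^ (- p)].

End L2.

Section process.
Context d (T : measurableType d) (R : realType) (P : probability T R).

(* The series converges in mean square at every point of [0,1]; taken together
   with the other clauses this forces [phi] to exhaust the eigenfunctions with
   nonzero eigenvalue (the covariance kernel equals the pointwise sum of
   lam k * phi k s * phi k t) and selects their continuous representatives. *)
Record karhunen_loeve (W : R -> {RV P >-> R}) (lam : nat -> R)
    (phi : nat -> R -> R) (Z : nat -> {RV P >-> R}) : Prop := KarhunenLoeve {
  kl_gaussian : gaussian_process W;
  kl_mean_zero : mean_zero W;
  kl_cov_continuous : {within (`[0, 1] : set R) `*` (`[0, 1] : set R),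
    continuous (fun st : R * R => cov_kernel W st.1 st.2)};
  kl_eigenvalue_gt0 : forall k, 0 < lam k;
  kl_eigenpair : forall k, eigenpair (cov_kernel W) (lam k) (phi k);
  kl_orthonormal : orthonormal_L2 phi;
  kl_iid : iid_standard_normal Z;
  kl_series : forall t : R, t \in `[0, 1] ->
    'E_P[fun w => ((W t w -
      \sum_(k < n) Num.sqrt (lam k) * phi k t * Z k w) ^+ 2)%R]%E
      @[n --> \oo] --> 0%E }.

Definition alpha_star (W : R -> {RV P >-> R}) (x : R) : \bar R :=
  ereal_sup [set alpha%:E | alpha in [set alpha : R |
    (limf_esup (fun h : R =>
       'E_P[fun w => ((W (x + h) w - W x w) ^+ 2)%R] / (h `^ alpha)%:E)
     0^'+ < +oo)%E]].

End process.

(* Main.v *)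
(* Write D_k(h) = phi_k(x + h) - phi_k(x).  Mean square convergence of the series
   and the orthogonality of the Z_k make E[(W(x + h) - W(x))^2] comparable, up to
   multiplicative constants, to S(h) = sum_k lam_k D_k(h)^2.  The exponent is
   insensitive to constants, so the crude inequality f^2 <= 2 g^2 + 2 (f - g)^2 is
   enough for the comparison, and of E[Z_k^2] only positivity and finiteness matter.
   Upper bound: min(1, t)^2 <= t^b for 0 <= b <= 2 gives
   S(h) <= const * h^b * sum_k k^(q b - p), a convergent series for b < (p - 1) / q.
   Lower bound: the window in hypothesis (iii) contributes at least
   const * h^(p / q) * h^(- 1 / q), and the single term with phi_k'(x) != 0 at least
   const * h^2. *)
Require Import Defs.
From HB Require Import structures.
From mathcomp Require Import all_boot all_order all_algebra.
From mathcomp Require Import all_classical all_reals all_analysis.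
From mathcomp Require Import measurable_realfun ring lra.

Import Order.TTheory GRing.Theory Num.Theory.
Import numFieldNormedType.Exports.
Local Open Scope classical_set_scope.
Local Open Scope ring_scope.

Set Implicit Arguments.
Unset Strict Implicit.

(** * The standard normal law: symmetry, second moment, orthogonality *)

Lemma normal_prob0N {R : realType} (A : set (measurableTypeR R)) : measurable A ->
  normal_prob 0 1 (-%R @^-1` A) = normal_prob 0 1 A.
Proof.
move=> mA; rewrite /normal_prob.
have mpdf : measurable_fun setT (fun x : R => (normal_pdf 0 1 x)%:E).
  by apply/measurable_EFinP; exact: measurable_normal_pdf.
transitivity (\int[lebesgue_measure]_(x in (-%R : _ -> measurableTypeR R) @^-1` A)
    (((EFin \o normal_pdf 0 1) \o -%R) x))%E.
  apply: eq_integral => x _ /=; congr EFin.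
  by rewrite !normal_pdfE ?oner_eq0// /normal_fun !subr0 sqrrN.
rewrite -ge0_integral_pushforward//=; last 2 first.
- exact: (measurable_funTS mpdf).
- by move=> y _; rewrite lee_fin normal_pdf_ge0.
apply: eq_measure_integral => B mB BA; exact: lebesgue_measureN.
Qed.

(** Change of variables holds for the Radon-Nikodym derivative, which agrees almost everywhere with
    [normal_pdf] because both have the same integral over every measurable set. *)
Lemma ge0_integral_normal_prob {R : realType} (m s : R) (f : R -> \bar R) :
  measurable_fun setT f -> (forall x, 0 <= f x)%E ->
  (\int[normal_prob m s]_x f x =
   \int[lebesgue_measure]_x (f x * (normal_pdf m s x)%:E))%E.
Proof.
move=> mf f0; have dom := normal_prob_dominates m s.
rewrite -(Radon_Nikodym_SigmaFinite.change_of_variables dom)//.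
have mg : lebesgue_measure.-integrable setT
    (Radon_Nikodym_SigmaFinite.f (normal_prob m s) (@lebesgue_measure R)).
  exact: Radon_Nikodym_SigmaFinite.f_integrable.
apply: ae_eq_integral => //.
- by apply: emeasurable_funM => //; exact: measurable_int mg.
- apply: emeasurable_funM => //.
  by apply/measurable_EFinP; exact: measurable_normal_pdf.
- apply: ae_eqe_mul2l; apply: integral_ae_eq => //.
  + by apply/measurable_EFinP; exact: measurable_normal_pdf.
  + by move=> E _ mE; rewrite -Radon_Nikodym_SigmaFinite.f_integral.
Qed.

Definition normal_moment2 (R : realType) : \bar R :=
  (\int[normal_prob 0 1]_x (x ^+ 2)%:E)%E.

(* From x^2 / 4 <= exp (x^2 / 4): the second moment is dominated by a Gaussian
   density of variance 2. *)
Lemma sqr_normal_pdf_le {R : realType} (x : R) :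
  x ^+ 2 * normal_pdf 0 1 x <=
  4 * normal_peak 1 / normal_peak (Num.sqrt 2) * normal_pdf 0 (Num.sqrt 2) x.
Proof.
have s2 : Num.sqrt 2 != 0 :> R by rewrite gt_eqF// sqrtr_gt0.
rewrite !normal_pdfE ?oner_eq0// (mulrA _ (normal_peak (Num.sqrt 2))) divfK; last first.
  by rewrite gt_eqF// normal_peak_gt0.
rewrite mulrCA (mulrC 4) -[leRHS]mulrA; apply: ler_wpM2l; first exact: normal_peak_ge0.
rewrite /normal_fun subr0 sqr_sqrtr// expr1n.
have -> : - x ^+ 2 / (1 *+ 2) = - (x ^+ 2 / 4) + - x ^+ 2 / (2 *+ 2) :> R by field.
rewrite expRD mulrA ler_wpM2r ?expR_ge0// expRN -ler_pdivlMr ?invr_gt0 ?expR_gt0//.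
rewrite invrK -ler_pdivrMl// mulrC.
by have := expR_ge1Dx (x ^+ 2 / 4); lra.
Qed.

Lemma normal_moment2_lty (R : realType) : (normal_moment2 R < +oo)%E.
Proof.
rewrite /normal_moment2 ge0_integral_normal_prob; last 2 first.
- by apply/measurable_EFinP; exact: measurable_funX.
- by move=> x; rewrite lee_fin sqr_ge0.
set c : R := 4 * normal_peak 1 / normal_peak (Num.sqrt 2).
have c0 : 0 <= c by rewrite !mulr_ge0 ?invr_ge0 ?normal_peak_ge0.
apply: (@le_lt_trans _ _ (\int[lebesgue_measure]_x
    (c%:E * (normal_pdf 0 (Num.sqrt 2) x)%:E))%E).
  apply: ge0_le_integral => //.
  - by move=> x _; rewrite mule_ge0// lee_fin ?sqr_ge0 ?normal_pdf_ge0.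
  - apply: emeasurable_funM; first by apply/measurable_EFinP; exact: measurable_funX.
    by apply/measurable_EFinP; exact: measurable_normal_pdf.
  - by apply: emeasurable_funM => //; apply/measurable_EFinP; exact: measurable_normal_pdf.
  - by move=> x _; rewrite -!EFinM lee_fin sqr_normal_pdf_le.
rewrite ge0_integralZl//; last 2 first.
- by apply/measurable_EFinP; exact: measurable_normal_pdf.
- by move=> x _; rewrite lee_fin normal_pdf_ge0.
by rewrite integral_normal_pdf mule1 ltry.
Qed.

(** A zero second moment would force x = 0 almost surely; but the point 0 is Lebesgue-null, hence
    null for the absolutely continuous normal law, and the total mass would vanish. *)
Lemma normal_moment2_gt0 (R : realType) : (0 < normal_moment2 R)%E.
Proof.
have ge0 : (0 <= normal_moment2 R)%E.
  by apply: integral_ge0 => x _; rewrite lee_fin sqr_ge0.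
rewrite lt_neqAle ge0 andbT; apply/eqP => /esym v0.
have mf : measurable_fun setT (fun x : R => (x ^+ 2)%:E).
  by apply/measurable_EFinP; exact: measurable_funX.
have := ae_eq_integral_abs (normal_prob (0 : R) 1) measurableT mf.
rewrite (_ : (\int[_]_(x in _) `|_|)%E = normal_moment2 R); last first.
  by apply: eq_integral => x _; rewrite gee0_abs// lee_fin sqr_ge0.
move=> [/(_ v0) + _].
have N0 : normal_prob (0 : R) 1 [set 0] = 0%E.
  have /null_content_dominatesP := normal_prob_dominates (0 : R) 1.
  by apply => //; exact: lebesgue_measure_set1.
move=> [N [mN N1 sub]].
pose Z : set (measurableTypeR R) := [set (0 : R)].
have mZ : measurable Z by exact: measurable_set1.
have : (normal_prob (0 : R) 1 setT <= normal_prob (0 : R) 1 (N `|` Z))%E.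
  apply: le_measure; rewrite ?inE//; first exact: measurableU.
  move=> x _; have [->|/eqP x0] := eqVneq x (0 : R); [by right|left; apply: sub => /=].
  by move=> /(_ I) [] /eqP; rewrite sqrf_eq0 => /eqP.
rewrite probability_setT leNgt => /negP; apply.
by rewrite (@measureU0 _ _ _ (normal_prob 0 1)) ?N1 ?lte01.
Qed.

(* The pairs (X, Y) and (- X, Y) have the same law, so E[XY] = - E[XY]. *)
Lemma independent_normal_expectationM d (T : measurableType d) (R : realType)
    (P : probability T R) (X Y : T -> measurableTypeR R) :
  measurable_fun setT X -> measurable_fun setT Y ->
  (forall A B : set (measurableTypeR R), measurable A -> measurable B ->
    P (X @^-1` A `&` Y @^-1` B) = normal_prob 0 1 A * normal_prob 0 1 B)%E ->
  P.-integrable setT (fun w => (X w * Y w)%:E) ->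
  (\int[P]_w (X w * Y w)%:E = 0)%E.
Proof.
move=> mX mY XY intXY.
pose G := measurableTypeR R.
have mXY : measurable_fun setT (fun w => @pair G G (X w) (Y w)) by exact: measurable_fun_pair.
have mNXY : measurable_fun setT (fun w => @pair G G (- X w) (Y w)).
  apply: measurable_fun_pair => //; exact: (@measurableT_comp _ _ _ _ G G (-%R : G -> G)).
pose U : {mfun T >-> (G * G)%type} := mfun_Sub (mem_set mXY).
pose V : {mfun T >-> (G * G)%type} := mfun_Sub (mem_set mNXY).
have mN : measurable_fun setT (-%R : G -> G) by [].
(* The product measure is determined by its values on rectangles, so it is the law of both pairs;
   for (- X, Y) this uses the symmetry of the normal law. *)
have lawU A : measurable A ->
    (product_measure1 (normal_prob 0 1) (normal_prob 0 1)) A = distribution P U A.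
  apply: product_measure_unique => B C mB mC; exact: XY.
have lawV A : measurable A ->
    (product_measure1 (normal_prob 0 1) (normal_prob 0 1)) A = distribution P V A.
  apply: product_measure_unique => B C mB mC.
  rewrite -[RHS]/(normal_prob 0 1 B * normal_prob 0 1 C)%E -(normal_prob0N mB) -XY//.
  by rewrite -[X in measurable X]setTI; exact: mN.
pose g (z : G * G) : \bar R := ((z.1 : R) * (z.2 : R))%:E.
have mg : measurable_fun setT g.
  by apply/measurable_EFinP; apply: measurable_funM.
have EU : (\int[distribution P U]_z g z = \int[P]_w (X w * Y w)%:E)%E.
  by rewrite integral_distribution.
have EV : (\int[distribution P V]_z g z = - \int[P]_w (X w * Y w)%:E)%E.
  rewrite integral_distribution//; last first.
    rewrite (_ : _ \o _ = -%E \o (fun w => (X w * Y w)%:E)).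
      exact: integrableN.
    by apply/funext => w; rewrite /g/= mulNr.
  rewrite -integralN; last exact: integrable_add_def.
  by apply: eq_integral => w _; rewrite /g/= mulNr.
have : (\int[distribution P U]_z g z = \int[distribution P V]_z g z)%E.
  by apply: eq_measure_integral => A mA _; exact: etrans (esym (lawU A mA)) (lawV A mA).
rewrite EU EV => E.
(* In the extended reals E = - E gives E = 0 only once E is known to be finite. *)
have fin := integrable_fin_num measurableT intXY.
move: E; rewrite -(fineK fin) -EFinN => -[E]; congr EFin; lra.
Qed.

(** * Second moments of finite combinations of the Z_k *)

Section iid_normal.
Context d (T : measurableType d) (R : realType) (P : probability T R).
Implicit Types (X : {RV P >-> R}) (Z : nat -> {RV P >-> R}).

Lemma normal_law_moment2 X : has_law P X (normal_prob 0 1) ->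
  (\int[P]_w (X w ^+ 2)%:E = normal_moment2 R)%E.
Proof.
move=> lawX.
(* R and measurableTypeR R carry convertible sigma-algebras under different displays *)
have mX : measurable_fun setT (X : T -> measurableTypeR R).
  by have h : measurable_fun setT X := measurable_funP X; exact: h.
pose Y : {mfun T >-> measurableTypeR R} := @mfun_Sub _ _ T (measurableTypeR R) X (mem_set mX).
transitivity (\int[distribution P Y]_x (x ^+ 2)%:E)%E.
  rewrite ge0_integral_distribution//.
  - by apply/measurable_EFinP; exact: measurable_funX.
  - by move=> x; rewrite lee_fin sqr_ge0.
by apply: eq_measure_integral => A mA _; exact: lawX.
Qed.

(** Domination by Z_j^2 + Z_k^2, whose expectation is finite. *)
Lemma iid_normal_integrableM Z j k : iid_standard_normal Z ->
  P.-integrable setT (fun w => (Z j w * Z k w)%:E).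
Proof.
move=> [_ law].
have int2 i : P.-integrable setT (fun w => (Z i w ^+ 2)%:E).
  apply/integrableP; split; first by apply/measurable_EFinP; exact: measurable_funX.
  under eq_integral do rewrite gee0_abs ?lee_fin ?sqr_ge0//.
  by rewrite normal_law_moment2// normal_moment2_lty.
apply: le_integrable (integrableD measurableT (int2 j) (int2 k)) => //.
  by apply/measurable_EFinP; exact: measurable_funM.
move=> w _ /=; rewrite lee_fin [leRHS]ger0_norm ?addr_ge0 ?sqr_ge0//.
by rewrite ler_norml; apply/andP; split; nra.
Qed.

Lemma iid_normal_orthogonal Z j k : iid_standard_normal Z ->
  (\int[P]_w (Z j w * Z k w)%:E = normal_moment2 R *+ (j == k))%E.
Proof.
move=> iidZ; have [indep law] := iidZ.
have [<-|jk] := eqVneq j k; first exact: normal_law_moment2.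
have mZ i : measurable_fun setT (Z i : T -> measurableTypeR R).
  by have h : measurable_fun setT (Z i) := measurable_funP (Z i); exact: h.
apply: (independent_normal_expectationM (mZ j) (mZ k)) => [A B mA mB|]; last first.
  exact: iid_normal_integrableM.
(* Independence is stated for a family of sets indexed by all naturals: take A at j and B elsewhere,
   and keep only the indices j and k. *)
have := indep [:: j; k] (fun i => if i == j then A else B).
rewrite /= inE jk => /(_ isT) H.
have /H : forall i, measurable (if i == j then A else B) by move=> i; case: ifP.
rewrite !big_cons big_nil mule1 eqxx (negbTE (_ : k != j)) 1?eq_sym// => E.
rewrite -(law j _ mA) -(law k _ mB) -E; congr (P _).
apply/seteqP; split => w /=.
- move=> [Aw Bw] i /=; rewrite !inE => /orP[]/eqP->; rewrite ?eqxx//.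
  by rewrite (negbTE (_ : k != j)) 1?eq_sym.
- move=> h; have := h j; have := h k; rewrite /= !inE !eqxx orbT => /(_ isT) + /(_ isT).
  by rewrite (negbTE (_ : k != j)) 1?eq_sym.
Qed.

(** Expand the square into a double sum; orthogonality leaves the diagonal. *)
Lemma iid_normal_expectation_sqr Z (a : nat -> R) n : iid_standard_normal Z ->
  ('E_P[fun w => ((\sum_(k < n) a k * Z k w) ^+ 2)%R] =
   (\sum_(k < n) a k ^+ 2)%:E * normal_moment2 R)%E.
Proof.
move=> iidZ; rewrite unlock.
have intM j k := iid_normal_integrableM j k iidZ.
transitivity (\int[P]_w \sum_(j < n) \sum_(k < n)
    (a j * a k)%:E * (Z j w * Z k w)%:E)%E.
  apply: eq_integral => w _; rewrite expr2 big_distrlr/= -sumEFin.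
  apply: eq_bigr => j _; rewrite -sumEFin; apply: eq_bigr => k _.
  by rewrite -EFinM mulrACA.
rewrite integral_sum//; last first.
  by move=> j; apply: integrable_sum => // k _; exact: integrableZl.
rewrite -sumEFin ge0_sume_distrl; last by move=> k _; rewrite lee_fin sqr_ge0.
apply: eq_bigr => j _; rewrite integral_sum//; last by move=> k; exact: integrableZl.
rewrite (bigD1 j)//= big1 ?adde0 => [|k kj].
  by rewrite integralZl// iid_normal_orthogonal// eqxx -expr2.
by rewrite integralZl// iid_normal_orthogonal// eq_sym (negbTE (_ : val k != val j))// mule0.
Qed.

End iid_normal.

(** Pointwise the difference of the two sides is (f - 2 g)^2. The integrands are nonnegative, so the
    inequality makes sense even when expectations are infinite. *)
Lemma expectation_sqr_le d (T : measurableType d) (R : realType)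
    (P : probability T R) (f g : T -> R) :
  measurable_fun setT f -> measurable_fun setT g ->
  ('E_P[fun w => (f w ^+ 2)%R] <= 2%:E * 'E_P[fun w => (g w ^+ 2)%R] +
    2%:E * 'E_P[fun w => ((f w - g w) ^+ 2)%R])%E.
Proof.
move=> mf mg; rewrite unlock.
have msqr (u : T -> R) : measurable_fun setT u ->
    measurable_fun setT (fun w => (u w ^+ 2)%:E).
  by move=> mu; apply/measurable_EFinP; exact: measurable_funX.
have mfg : measurable_fun setT (fun w => f w - g w) by exact: measurable_funB.
have intZ (u : T -> R) : measurable_fun setT u ->
    (2%:E * \int[P]_w (u w ^+ 2)%:E = \int[P]_w (2%:E * (u w ^+ 2)%:E))%E.
  move=> mu; rewrite ge0_integralZl//; first exact: msqr.
  by move=> w _; rewrite lee_fin sqr_ge0.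
rewrite (intZ _ mg) (intZ _ mfg).
rewrite -ge0_integralD//; last 4 first.
- by move=> w _; rewrite mule_ge0// lee_fin sqr_ge0.
- by apply: emeasurable_funM => //; exact: msqr.
- by move=> w _; rewrite mule_ge0// lee_fin sqr_ge0.
- by apply: emeasurable_funM => //; exact: msqr.
apply: ge0_le_integral => //.
- by move=> w _; rewrite lee_fin sqr_ge0.
- exact: msqr.
- by apply: emeasurable_funD; apply: emeasurable_funM => //; exact: msqr.
by move=> w _; rewrite -!EFinM -EFinD lee_fin; have := sqr_ge0 (f w - 2 * g w); nra.
Qed.

(** * Comparison of E[(W s - W t)^2] with the spectral sums *)

Section karhunen_loeve_increments.
Context d (T : measurableType d) (R : realType) (P : probability T R).
Variables (W : R -> {RV P >-> R}) (lam : nat -> R) (phi : nat -> R -> R).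
Variables (Z : nat -> {RV P >-> R}).
Hypothesis kl : karhunen_loeve W lam phi Z.
Variables (s t : R) (s01 : s \in `[0, 1]) (t01 : t \in `[0, 1]).

Let D w := W s w - W t w.
Let S n w := \sum_(k < n) (Num.sqrt (lam k) * (phi k s - phi k t)) * Z k w.
Let S1 r n w := \sum_(k < n) Num.sqrt (lam k) * phi k r * Z k w.

Let SE n w : S n w = S1 s n w - S1 t n w.
Proof.
by rewrite /S /S1 -sumrB; apply: eq_bigr => k _; rewrite mulrBr mulrBl.
Qed.

Let mS1 r n : measurable_fun setT (S1 r n).
Proof.
by apply: measurable_sum => k; exact: measurable_funM.
Qed.

Let mS n : measurable_fun setT (S n).
Proof.
by apply: measurable_sum => k; exact: measurable_funM.
Qed.

Let mD : measurable_fun setT D.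
Proof. exact: measurable_funB. Qed.

Let ES n : ('E_P[fun w => (S n w ^+ 2)%R] =
  (\sum_(k < n) lam k * (phi k s - phi k t) ^+ 2)%:E * normal_moment2 R)%E.
Proof.
rewrite (iid_normal_expectation_sqr
  (fun k => Num.sqrt (lam k) * (phi k s - phi k t)) n (kl_iid kl)).
congr (_%:E * _)%E; apply: eq_bigr => k _.
by rewrite exprMn sqr_sqrtr// ltW//; exact: kl_eigenvalue_gt0 kl k.
Qed.

Let cvg_DS : 'E_P[fun w => ((D w - S n w) ^+ 2)%R]%E @[n --> \oo] --> 0%E.
Proof.
pose e r n := 'E_P[fun w => ((W r w - S1 r n w) ^+ 2)%R]%E.
apply: (@squeeze_cvge _ _ _ _ (cst 0%E) _ (fun n => 2%:E * e s n + 2%:E * e t n)%E).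
- apply: nearW => n; rewrite expectation_ge0 => [|w]; last exact: sqr_ge0.
  have mr r : measurable_fun setT (fun w => W r w - S1 r n w) by exact: measurable_funB.
  have mDS : measurable_fun setT (fun w => D w - S n w) by exact: measurable_funB.
  apply: le_trans (expectation_sqr_le _ mDS (mr s)) _.
  rewrite leeD2l// lee_wpmul2l//.
  (* Subtracting the error at s from D - S_n leaves minus the error at t. *)
  rewrite (_ : (fun _ => _) = (fun w => (W t w - S1 t n w) ^+ 2))//.
  by apply/funext => w; rewrite /D SE; ring.
- exact: cvg_cst.
- have cvgs r : r \in `[0, 1] -> (2%:E * e r n)%E @[n --> \oo] --> 0%E.
    by move=> r01; rewrite -(mule0 2%:E); apply: cvgeZl => //; exact: kl_series kl r r01.
  by rewrite -[X in _ --> X]adde0; apply: cvgeD => //; exact: cvgs.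
Qed.

Let cvg_2DS : (2%:E * 'E_P[fun w => ((D w - S n w) ^+ 2)%R])%E @[n --> \oo] --> 0%E.
Proof. by rewrite -(mule0 2%:E); exact: cvgeZl. Qed.

(** E[D^2] <= 2 E[S_n^2] + 2 E[(D - S_n)^2]: the first term is bounded through M uniformly in n, and
    the second vanishes as n grows. *)
Lemma kl_increment_le (M : R) :
  (forall n, \sum_(k < n) lam k * (phi k s - phi k t) ^+ 2 <= M) ->
  ('E_P[fun w => ((W s w - W t w) ^+ 2)%R] <= (2 * M)%:E * normal_moment2 R)%E.
Proof.
move=> SM; have v0 := ltW (normal_moment2_gt0 R).
pose u n := ((2 * M)%:E * normal_moment2 R +
  2%:E * 'E_P[fun w => ((D w - S n w) ^+ 2)%R])%E.
have : u @ \oo --> ((2 * M)%:E * normal_moment2 R)%E.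
  rewrite -[X in _ --> X]adde0.
  apply: cvgeD; [by rewrite fin_num_adde_defl|exact: cvg_cst|exact: cvg_2DS].
move=> /cvge_to_ge; apply; apply: nearW => n.
apply: le_trans (expectation_sqr_le _ mD (mS n)) _.
rewrite leeD2r// ES muleA lee_wpmul2r// -EFinM lee_fin.
by rewrite ler_pM2l// SM.
Qed.

(** The roles of D and S are exchanged. The terms are nonnegative, so the n-th sum is at most the
    m-th for m >= n, and m can go to infinity with n fixed. *)
Lemma kl_increment_ge n :
  ((\sum_(k < n) lam k * (phi k s - phi k t) ^+ 2)%:E * normal_moment2 R <=
   2%:E * 'E_P[fun w => ((W s w - W t w) ^+ 2)%R])%E.
Proof.
have v0 := ltW (normal_moment2_gt0 R).
pose u n := (2%:E * 'E_P[fun w => (D w ^+ 2)%R] +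
  2%:E * 'E_P[fun w => ((D w - S n w) ^+ 2)%R])%E.
have : u @ \oo --> (2%:E * 'E_P[fun w => (D w ^+ 2)%R])%E.
  rewrite -[X in _ --> X]adde0.
  apply: cvgeD; [by rewrite fin_num_adde_defl|exact: cvg_cst|exact: cvg_2DS].
move=> /cvge_to_ge; apply; exists n => // m /= nm.
apply: (@le_trans _ _ ('E_P[fun w => (S m w ^+ 2)%R])%E).
  rewrite ES lee_wpmul2r// lee_fin -(subnKC nm) big_split_ord/= lerDl.
  apply: sumr_ge0 => k _; rewrite mulr_ge0 ?sqr_ge0// ltW//.
  exact: kl_eigenvalue_gt0 kl _.
apply: le_trans (expectation_sqr_le _ (mS m) mD) _.
rewrite /u (_ : (fun w => (S m w - D w) ^+ 2) = (fun w => (D w - S m w) ^+ 2))//.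
by apply/funext => w; rewrite -sqrrN opprB.
Qed.

End karhunen_loeve_increments.

(** * Power sums and growth exponents *)

(** After division by u^(-r) this reads 1 + r / u <= (1 - 1/u)^(-r) = exp(- r ln(1 - 1/u)), which
    follows from exp y >= 1 + y and ln(1 - 1/u) <= - 1/u. *)
Lemma powR_telescope {R : realType} (r u : R) : 0 < r -> 1 < u ->
  r * u `^ (- (r + 1)) <= (u - 1) `^ (- r) - u `^ (- r).
Proof.
move=> r0 u1; have u0 : 0 < u by lra.
have iu : 0 < u^-1 < 1 by rewrite invr_gt0 u0 invf_lt1.
have -> : u - 1 = u * (1 - u^-1) by rewrite mulrBr mulr1 divff// gt_eqF.
rewrite powRM ?(ltW u0)//; last by lra.
have -> : u `^ (- (r + 1)) = u `^ (- r) / u.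
  by rewrite opprD powRD ?(gt_eqF u0) ?implybT// powR_inv1// ltW.
suff : 1 + r / u <= (1 - u^-1) `^ (- r).
  by move=> H; have := powR_gt0 (- r) u0; nra.
rewrite /powR gt_eqF; last by lra.
apply: le_trans (expR_ge1Dx _); rewrite lerD2l mulNr -mulrN ler_pM2l// lerNr.
by apply: le_ln1Dx; lra.
Qed.

Lemma sum_powR_le {R : realType} (s : R) (n : nat) : 1 < s ->
  \sum_(k < n) k.+1%:R `^ (- s) <= 1 + (s - 1)^-1.
Proof.
move=> s1; have r0 : 0 < s - 1 by lra.
case: n => [|n]; first by rewrite big_ord0 addr_ge0// invr_ge0 ltW.
(* The bound is strengthened by the tail term of the integral comparison so that the induction step
   is exactly [powR_telescope] with r = s - 1. *)
suff : \sum_(k < n.+1) k.+1%:R `^ (- s) <=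
    1 + (s - 1)^-1 * (1 - n.+1%:R `^ (- (s - 1))).
  move=> /le_trans; apply; rewrite lerD2l ler_piMr ?invr_ge0 ?(ltW r0)//.
elim: n => [|n IHn].
  by rewrite big_ord_recl big_ord0 !powR1 subrr mulr0.
rewrite big_ord_recr/=; apply: le_trans (lerD IHn (lexx _)) _.
have := @powR_telescope R (s - 1) n.+2%:R r0.
rewrite ltr1n => /(_ isT); rewrite (_ : n.+2%:R - 1 = n.+1%:R); last first.
  by rewrite -natr1 addrK.
rewrite subrK => H; rewrite -addrA lerD2l -lerBrDl -mulrBr mulrC -ler_pdivrMr ?invr_gt0//.
by rewrite invrK; lra.
Qed.

(** For t >= 1 compare exponents 0 and b; for t < 1 compare exponents 2 and b. *)
Lemma min1_sqr_le_powR {R : realType} (t b : R) : 0 < t -> 0 <= b <= 2 ->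
  Num.min 1 t ^+ 2 <= t `^ b.
Proof.
move=> t0 /andP[b0 b2]; have [t1|t1] := leP 1 t.
  by rewrite expr1n -(powRr0 t) ler_powR.
by rewrite -powR_mulrn ?(ltW t0)// ger_powR// t0 ltW.
Qed.

(** An admissible a > m would give c h^m <= K h^a, so c / K <= h^(a - m), which tends to 0.
    Conversely every b in [0, m) is admissible, and such b approach m. *)
Lemma ereal_sup_growth_exponent {R : realType} (V : R -> \bar R) (m : R) :
  0 < m ->
  (forall b, 0 <= b < m -> exists M : R,
     \forall h \near 0^'+, (V h <= (M * h `^ b)%:E)%E) ->
  (exists2 c : R, 0 < c & \forall h \near 0^'+, ((c * h `^ m)%:E <= V h)%E) ->
  ereal_sup [set a%:E | a in [set a : R |
    (limf_esup (fun h : R => V h / (h `^ a)%:E) 0^'+ < +oo)%E]] = m%:E.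
Proof.
move=> m0 up [c c0 low]; apply/eqP; rewrite eq_le; apply/andP; split.
  apply: ge_ereal_sup => _ [a /= + <-]; rewrite lee_fin.
  (* [limf_esup] is an infimum of suprema over the sets of the filter, so finiteness provides one
     set A on which the ratio is bounded above. *)
  move=> /ereal_inf_lt[_ [A A0 <-]] supA; rewrite leNgt; apply/negP => ma.
  have [K K0 supK] : exists2 K : R, 0 < K &
      (ereal_sup [set V h / (h `^ a)%:E | h in A] <= K%:E)%E.
    case: (ereal_sup _) supA => [r _||]//.
      by exists (Num.max r 1); rewrite ?lt_max ?ltr01 ?orbT// lee_fin le_max lexx.
    by exists 1; rewrite ?ltr01// leNye.
  have am0 : 0 < a - m by rewrite subr_gt0.
  have /cvgr_lt /(_ (c / K)) small := powR_cvg0 am0.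
  have /small{}small : 0 < c / K by rewrite divr_gt0.
  suff : \forall h \near (0 : R)^'+, False by case/filter_ex.
  near=> h; have h0 : 0 < h by near: h; exact: nbhs_right_gt.
  have hA : A h by near: h.
  have Vle : (V h / (h `^ a)%:E <= K%:E)%E.
    by apply: le_trans supK; apply: ereal_sup_ubound; exists h.
  have cV : ((c * h `^ m)%:E <= V h)%E by near: h.
  have hm0 := powR_gt0 m h0; have ha0 := powR_gt0 a h0.
  have : ((c * h `^ m / h `^ a)%:E <= K%:E)%E.
    apply: le_trans Vle; rewrite inver gt_eqF// EFinM.
    by rewrite lee_wpmul2r// lee_fin invr_ge0 ltW.
  rewrite lee_fin ler_pdivrMr// => H.
  have : h `^ (a - m) < c / K by near: h.
  rewrite powRB ?(gt_eqF h0) ?implybT// ltr_pdivrMr// mulrAC ltr_pdivlMr// mulrC.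
  by move=> /(le_lt_trans H); rewrite ltxx.
apply/lee_addgt0Pr => e e0; rewrite -leeBlDr// -EFinB.
(* Truncated at 0 because e may exceed m while [up] concerns nonnegative exponents; b < m still
   holds since m and e are positive. *)
pose b := Num.max 0 (m - e).
apply: (@le_trans _ _ b%:E); first by rewrite lee_fin le_max lexx orbT.
apply: ereal_sup_ubound; exists b => //=.
have [|M VM] := up b; first by rewrite le_max lexx/= gt_max m0/=; lra.
apply: (@le_lt_trans _ _ M%:E); last exact: ltry.
apply: ge_ereal_inf; eexists; first by
  exists [set h | 0 < h /\ (V h <= (M * h `^ b)%:E)%E] => //; near=> h; split; near: h;
  [exact: nbhs_right_gt|exact: VM].
apply: ge_ereal_sup => _ [h /= [h0 Vh] <-].
have hb0 := powR_gt0 b h0.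
rewrite inver gt_eqF//; apply: le_trans (lee_wpmul2r _ Vh) _.
  by rewrite lee_fin invr_ge0 ltW.
by rewrite -EFinM mulfK ?gt_eqF.
Unshelve. all: by end_near.
Qed.

(** * Deterministic bounds on the sums of lam_k D_k^2 *)

Section spectral_sums.
Context {R : realType}.
Implicit Types (lam D : nat -> R) (h p q b c C Bl Bu l : R).

(** Each term is at most Bu C^2 h^b k^(q b - p), with k the rank; [sum_powR_le] applies with s = p -
    q b > 1. *)
Lemma sum_spectral_le lam D h p q b C Bu (n : nat) :
  0 < h -> 0 < C -> 0 < Bu -> 0 <= b <= 2 -> q * b < p - 1 ->
  (forall k, lam k <= Bu * k.+1%:R `^ (- p)) ->
  (forall k, `|D k| <= C * Num.min 1 (h * k.+1%:R `^ q)) ->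
  \sum_(k < n) lam k * D k ^+ 2 <=
  Bu * C ^+ 2 * (1 + (p - q * b - 1)^-1) * h `^ b.
Proof.
move=> h0 C0 B0 b02 qb lamU DU.
apply: (@le_trans _ _ (Bu * C ^+ 2 * h `^ b *
    \sum_(k < n) k.+1%:R `^ (- (p - q * b)))); last first.
  have BC : 0 <= Bu * C ^+ 2 by apply: mulr_ge0; [exact: ltW|exact: sqr_ge0].
  rewrite mulrAC ler_wpM2r ?powR_ge0// ler_wpM2l//.
  by apply: sum_powR_le; lra.
rewrite mulr_sumr; apply: ler_sum => k _.
have k0 : 0 < k.+1%:R :> R by rewrite ltr0n.
have t0 : 0 < h * k.+1%:R `^ q by rewrite mulr_gt0// powR_gt0.
have D2 : D k ^+ 2 <= C ^+ 2 * (h * k.+1%:R `^ q) `^ b.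
  apply: (@le_trans _ _ ((C * Num.min 1 (h * k.+1%:R `^ q)) ^+ 2)).
    rewrite -(real_normK (num_real (D k))) lerXn2r ?nnegrE//.
    exact: le_trans (DU k).
  by rewrite exprMn ler_wpM2l ?sqr_ge0// min1_sqr_le_powR.
apply: (@le_trans _ _ (Bu * k.+1%:R `^ (- p) * (C ^+ 2 * (h * k.+1%:R `^ q) `^ b))).
  apply: (@le_trans _ _ (Bu * k.+1%:R `^ (- p) * D k ^+ 2)).
    by rewrite ler_wpM2r ?sqr_ge0.
  by rewrite ler_wpM2l// mulr_ge0 ?powR_ge0// ltW.
rewrite powRM ?powR_ge0 ?(ltW h0)// -powRrM opprB addrC powRD ?(gt_eqF k0) ?implybT//.
by rewrite le_eqVlt; apply/orP; left; apply/eqP; ring.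
Qed.

(** With y = h^(-1/q), ranks in the window are at most b y, so their eigenvalues are at least Bl (b
    y)^(-p). Multiplying by c y gives the power y^(1 - p) = h^((p - 1) / q). *)
Lemma sum_spectral_ge_window lam D h p q a b c Bl :
  0 < h -> 0 < b -> 0 < p -> 0 < Bl ->
  (forall k, Bl * k.+1%:R `^ (- p) <= lam k) ->
  c * h `^ (- q^-1) <=
    \sum_(k \in [set k : nat | a * h `^ (- q^-1) <= k.+1%:R <= b * h `^ (- q^-1)])
      D k ^+ 2 ->
  exists n, Bl * b `^ (- p) * c * h `^ ((p - 1) / q) <=
    \sum_(k < n) lam k * D k ^+ 2.
Proof.
move=> h0 b0 p0 B0 lamL; set y := h `^ (- q^-1); set A := [set _ | _] => cA.
have y0 : 0 < y by rewrite powR_gt0.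
have by0 : 0 < b * y by rewrite mulr_gt0.
(* Index k has rank k.+1, and k.+1 <= b y means k < n. The window is thus finite, and its sum
   becomes an ordinary sum over k < n with zeros outside the window. *)
pose n := Num.truncn (b * y); exists n.
have An : A `<=` `I_n.
  by move=> k /= /andP[_ kby]; rewrite /n truncn_gt_nat.
rewrite -(setIidr An) fsbig_mkcondr -fsbig_ord in cA.
have -> : Bl * b `^ (- p) * c * h `^ ((p - 1) / q) =
    Bl * (b * y) `^ (- p) * (c * y).
  rewrite powRM ?(ltW b0) ?(ltW y0)//.
  have -> : h `^ ((p - 1) / q) = y `^ (- p) * y.
    rewrite -[X in _ = _ * X]powRr1 ?(ltW y0)// -powRD ?(gt_eqF y0) ?implybT//.
    by rewrite /y -powRrM; congr powR; ring.
  by ring.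
have c1 : 0 <= Bl * (b * y) `^ (- p) by rewrite mulr_ge0 ?powR_ge0// ltW.
apply: le_trans (ler_wpM2l c1 cA) _; rewrite mulr_sumr; apply: ler_sum => k _.
have lam0 : 0 <= lam k.
  by apply: le_trans (lamL k); rewrite mulr_ge0 ?powR_ge0// ltW.
case: ifPn => [|_]; last by rewrite mulr0 mulr_ge0 ?sqr_ge0.
rewrite inE => /= /andP[_ kby]; rewrite ler_wpM2r ?sqr_ge0//.
apply: le_trans (lamL k); rewrite ler_wpM2l ?(ltW B0)//.
rewrite !powRN lef_pV2 ?posrE ?powR_gt0 ?ltr0n//.
by rewrite ge0_ler_powR ?nnegrE ?(ltW p0) ?(ltW by0).
Qed.

(** The absolute difference quotient tends to |l|, so it eventually exceeds |l| / 2 when l is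
    nonzero; x < 1 keeps x + h inside [0,1] for small h. *)
Lemma has_derivative_increment_ge (f : R -> R) (x l : R) :
  0 <= x < 1 -> has_derivative f x l ->
  \forall h \near 0^'+, `|l| / 2 * h <= `|f (x + h) - f x|.
Proof.
move=> /andP[x0 x1] fl.
have [->|l0] := eqVneq l 0; first by apply: nearW => h; rewrite normr0 !mul0r.
have l2 : `|l| / 2 < `|l| by rewrite ltr_pdivrMr// ltr_pMr ?normr_gt0// ltr1n.
have FF : Filter (within `[0, 1] x^') by exact: within_filter.
have near_l : \forall y \near within `[0, 1] x^', `|l| / 2 < `|(f y - f x) / (y - x)|.
  exact: (@cvgr_gt _ _ _ _ _ _ (cvg_norm fl) _ l2).
rewrite !near_withinE in near_l.
have /nbhs_right0P near_r : \forall y \near x^'+, y \in `[0, 1] ->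
    `|l| / 2 < `|(f y - f x) / (y - x)|.
  rewrite near_withinE; apply: filterS near_l => y H xy y01.
  by apply: H => //=; rewrite gt_eqF.
near=> h; have h0 : 0 < h by near: h; exact: nbhs_right_gt.
have xh : x + h \in `[0, 1].
  rewrite in_itv/= addr_ge0 ?(ltW h0)//= -lerBrDl.
  by near: h; apply: nbhs_right_ltW; rewrite subr_gt0.
have : `|l| / 2 < `|(f (x + h) - f x) / (x + h - x)|.
  by move: xh; near: h.
rewrite addrAC subrr add0r normrM normfV (gtr0_norm h0) ltr_pdivlMr//.
exact: ltW.
Unshelve. all: by end_near.
Qed.

End spectral_sums.

(** * The exponent of a Karhunen-Loeve process *)

Section growth_exponent.
Context {R : realType} (phi : nat -> R -> R) (x q : R).
Hypotheses (x01 : 0 <= x < 1) (q_gt0 : 0 < q).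
Hypothesis increments_le : exists2 C : R, 0 < C &
  \forall h \near 0^'+, forall k : nat,
    `|phi k (x + h) - phi k x| <= C * Num.min 1 (h * k.+1%:R `^ q).
Hypothesis increments_ge : exists a b c : R, [/\ 0 < a, a < b, 0 < c &
  \forall h \near 0^'+,
    c * h `^ (- q^-1) <=
    \sum_(k \in [set k : nat |
        a * h `^ (- q^-1) <= k.+1%:R <= b * h `^ (- q^-1)])
      (phi k (x + h) - phi k x) ^+ 2].
Hypothesis derivative_neq0 : exists k l, has_derivative (phi k) x l /\ l != 0.
Context d (T : measurableType d) (P : probability T R).
Variables (W : R -> {RV P >-> R}) (lam : nat -> R) (Z : nat -> {RV P >-> R}).
Variable p : R.
Hypotheses (p_gt1 : 1 < p) (kl : karhunen_loeve W lam phi Z).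
Hypothesis decay : power_decay lam p.

Let m : R := Num.min 2 ((p - 1) / q).
Let S h n := \sum_(k < n) lam k * (phi k (x + h) - phi k x) ^+ 2.

(** The case split follows the minimum in m: the term with nonzero derivative yields h^2, the window
    yields h^((p - 1) / q). The truncation n may depend on h. *)
Lemma spectral_lower_bound : exists2 c : R, 0 < c &
  \forall h \near 0^'+, exists n, c * h `^ m <= S h n.
Proof.
have [Bl [Bu [Bl0 BlBu lamB]]] := decay.
have lamL k : Bl * k.+1%:R `^ (- p) <= lam k by have /andP[] := lamB k.
rewrite /m; have [_|_] := leP 2 ((p - 1) / q).
  have [k [l [der l0]]] := derivative_neq0.
  have lamk0 := kl_eigenvalue_gt0 kl k.
  exists (lam k * (`|l| / 2) ^+ 2).
    by rewrite mulr_gt0// exprn_gt0// divr_gt0// normr_gt0.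
  have Dk := has_derivative_increment_ge x01 der.
  near=> h; have h0 : 0 < h by near: h; exact: nbhs_right_gt.
  exists k.+1; rewrite /S big_ord_recr/=.
  apply: ler_wpDl.
    apply: sumr_ge0 => i _; rewrite mulr_ge0 ?sqr_ge0// ltW//.
    exact: kl_eigenvalue_gt0 kl i.
  rewrite powR_mulrn ?(ltW h0)// -mulrA -exprMn ler_wpM2l ?(ltW lamk0)//.
  rewrite -(real_normK (num_real (_ - _))) lerXn2r ?nnegrE//.
    by rewrite mulr_ge0 ?divr_ge0 ?(ltW h0).
  by near: h.
have [a [b [c [a0 ab c0 winh]]]] := increments_ge.
exists (Bl * b `^ (- p) * c).
  by rewrite !mulr_gt0// powR_gt0; lra.
near=> h; have h0 : 0 < h by near: h; exact: nbhs_right_gt.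
apply: (@sum_spectral_ge_window _ lam (fun k => phi k (x + h) - phi k x) h p q a b)
  => //.
- exact: lt_trans ab.
- exact: lt_trans p_gt1.
- by near: h.
Unshelve. all: by end_near.
Qed.

Lemma spectral_upper_bound b : 0 <= b < m -> exists M : R,
  \forall h \near 0^'+, forall n, S h n <= M * h `^ b.
Proof.
rewrite /m lt_min => /and3P[b0 b2 bpq].
have [Bl [Bu [Bl0 BlBu lamB]]] := decay.
have [C C0 DC] := increments_le.
exists (Bu * C ^+ 2 * (1 + (p - q * b - 1)^-1)).
near=> h => n; apply: (@sum_spectral_le _ lam (fun k => phi k (x + h) - phi k x)) => //.
- exact: lt_le_trans BlBu.
- by rewrite b0 ltW.
- by rewrite mulrC -ltr_pdivlMr.
- by move=> k; have /andP[] := lamB k.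
- by near: h.
Unshelve. all: by end_near.
Qed.

Lemma alpha_star_karhunen_loeve : alpha_star W x = m%:E.
Proof.
have [v v0 vE] : exists2 v : R, 0 < v & normal_moment2 R = v%:E.
  have := normal_moment2_lty R; have := normal_moment2_gt0 R.
  by case: (normal_moment2 R) => [r||]//; rewrite lte_fin => r0 _; exists r.
have [x0 x1] := andP x01.
have xI : x \in `[0, 1] by rewrite in_itv/= x0 ltW.
have xhI : \forall h \near 0^'+, x + h \in `[0, 1].
  near=> h; rewrite in_itv/= addr_ge0//=.
  by rewrite -lerBrDl; near: h; apply: nbhs_right_ltW; rewrite subr_gt0.
apply: ereal_sup_growth_exponent.
- by rewrite /m lt_min ltr0n divr_gt0 ?subr_gt0.
(* The factor 2 here, and the division by 2 in the lower bound, come from the crude comparison of W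
   with its partial sums. *)
- move=> b /spectral_upper_bound[M SM]; exists (2 * M * v).
  near=> h; have xh : x + h \in `[0, 1] by near: h.
  have Sh : forall n, S h n <= M * h `^ b by near: h.
  have := kl_increment_le kl xh xI Sh; rewrite vE -EFinM => /le_trans; apply.
  by rewrite lee_fin le_eqVlt; apply/orP; left; apply/eqP; ring.
- have [c c0 Sc] := spectral_lower_bound; exists (c * v / 2).
    by rewrite divr_gt0 ?mulr_gt0.
  near=> h; have xh : x + h \in `[0, 1] by near: h.
  have [n Sn] : exists n, c * h `^ m <= S h n by near: h.
  have := kl_increment_ge kl xh xI n; rewrite vE -EFinM.
  (* An infinite second moment satisfies the lower bound trivially, and -oo contradicts the
     comparison. *)
  case: ('E_P[_])%E => [r||].
  + rewrite -EFinM !lee_fin => H.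
    have : c * h `^ m * v <= S h n * v by rewrite ler_wpM2r// ltW.
    by rewrite /S; lra.
  + by rewrite leey.
  + by rewrite mulrNy gtr0_sg// mul1e.
Unshelve. all: by end_near.
Qed.

End growth_exponent.

Unset Implicit Arguments.

Theorem mainTheorem6 (R : realType) (phi : nat -> R -> R) (x q : R)
    (x01 : 0 <= x < 1) (q_gt0 : 0 < q)
    (increments_le : exists2 C : R, 0 < C &
       \forall h \near 0^'+, forall k : nat,
         `|phi k (x + h) - phi k x| <= C * Num.min 1 (h * k.+1%:R `^ q))
    (increments_ge : exists a b c : R, [/\ 0 < a, a < b, 0 < c &
       \forall h \near 0^'+,
         c * h `^ (- q^-1) <=
         \sum_(k \in [set k : nat |
             a * h `^ (- q^-1) <= k.+1%:R <= b * h `^ (- q^-1)])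
           (phi k (x + h) - phi k x) ^+ 2])
    (derivative_neq0 : exists k l, has_derivative (phi k) x l /\ l != 0) :
  (forall (d : measure_display) (T : measurableType d) (P : probability T R)
     (W : R -> {RV P >-> R}) (lam : nat -> R) (Z : nat -> {RV P >-> R}) (p : R),
     1 < p -> karhunen_loeve W lam phi Z -> power_decay lam p ->
     alpha_star W x = (Num.min 2 ((p - 1) / q))%:E)
  /\
  (forall (d1 d2 : measure_display)
     (T1 : measurableType d1) (T2 : measurableType d2)
     (P1 : probability T1 R) (P2 : probability T2 R)
     (W1 : R -> {RV P1 >-> R}) (W2 : R -> {RV P2 >-> R})
     (lam1 lam2 : nat -> R)
     (Z1 : nat -> {RV P1 >-> R}) (Z2 : nat -> {RV P2 >-> R}) (p1 p2 : R),
     1 < p1 -> 1 < p2 ->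
     karhunen_loeve W1 lam1 phi Z1 -> power_decay lam1 p1 ->
     karhunen_loeve W2 lam2 phi Z2 -> power_decay lam2 p2 ->
     (p1 <= p2 -> (alpha_star W1 x <= alpha_star W2 x)%E) /\
     (p1 < p2 -> p2 < 1 + 2 * q -> (alpha_star W1 x < alpha_star W2 x)%E)).
Proof.
(* The formula stays general in the probability space, the process and p, so it applies to both
   processes sharing the basis phi. *)
have alphaE := alpha_star_karhunen_loeve x01 q_gt0 increments_le increments_ge
  derivative_neq0.
split; first by move=> d T P W lam Z p; exact: alphaE.
move=> d1 d2 T1 T2 P1 P2 W1 W2 lam1 lam2 Z1 Z2 p1 p2 p1_gt1 p2_gt1 kl1 dec1 kl2 dec2.
rewrite (alphaE _ _ _ _ _ _ _ p1_gt1 kl1 dec1) (alphaE _ _ _ _ _ _ _ p2_gt1 kl2 dec2).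
split=> [p12|p12 p2q].
  by rewrite lee_fin le_min2// ler_pM2r ?invr_gt0// lerB.
(* Below 1 + 2 q the cap 2 is inactive, so strict monotonicity of (p - 1) / q passes to the
   minimum. *)
have p2q2 : (p2 - 1) / q < 2 by rewrite ltr_pdivrMr//; lra.
have p1p2 : (p1 - 1) / q < (p2 - 1) / q by rewrite ltr_pM2r ?invr_gt0// ltrD2r.
by rewrite lte_fin lt_min !gt_min p1p2 (lt_trans p1p2 p2q2) !orbT.
Qed.
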